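(* Let $T$ be a nonnegative tensor of order $m$ and dimension $n$, and let $E$ be the identity tensor of order $m$ and dimension $n$. Then: (1) $T$ is weakly irreducible if and only if $T+E$ is weakly primitive; (2) $T$ is irreducible if and only if $T+E$ is primitive; (3) $T$ is weakly positive if and only if $T+E$ is essentially positive; (4) $T$ is essentially positive if and only if it is weakly positive and all of its diagonal elements $T_{i\ldots i}$ are positive.
   Context: Throughout $m,n\ge 2$. A tensor $T$ of order $m$ and dimension $n$ is a real array $(T_{i_1\ldots i_m})$, $i_1,\dots,i_m\in\{1,\ldots,n\}$; it is nonnegative if all entries are nonnegative. $(Tx^{m-1})_i=\sum_{i_2,\ldots,i_m=1}^n T_{ii_2\ldots i_m}x_{i_2}\cdots x_{i_m}$. $E$ has diagonal elements ($i_1=\cdots=i_m$) equal to $1$ and all other elements $0$. $\mathbb{R}^n_+$ (resp. $\mathbb{R}^n_{++}$) is the set of vectors with all components $\ge 0$ (resp. $>0$). For nonnegative $T$, $F_T:\mathbb{R}^n_+\to\mathbb{R}^n_+$ is $(F_T)_i(x)=\left((Tx^{m-1})_i\right)^{1/(m-1)}$, and $F_T^k$ is its $k$-th iterate. For a nonnegative tensor $T$: - $T$ is reducible if there is a nonempty proper subset $I\subset\{1,\ldots,n\}$ with $T_{i_1i_2\ldots i_m}=0$ for all $i_1\in I$ and all $i_2,\ldots,i_m\notin I$; otherwise $T$ is irreducible. - $T$ is essentially positive if $Tx^{m-1}\in\mathbb{R}^n_{++}$ for every nonzero $x\in\mathbb{R}^n_+$. - $T$ is primitive if there is a positive integer $k$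 such that $F_T^k(x)\in\mathbb{R}^n_{++}$ for every nonzero $x\in\mathbb{R}^n_+$. - $T$ is weakly positive if $T_{ij\ldots j}>0$ for all $i\ne j$. - The representation $G(T)$ is the nonnegative $n\times n$ matrix whose $(i,j)$ entry is the sum of all $T_{ii_2\ldots i_m}$ over $(i_2,\ldots,i_m)$ with $j\in\{i_2,\ldots,i_m\}$. $T$ is weakly irreducible if $G(T)$ is an irreducible matrix, and weakly primitive if $G(T)$ is a primitive matrix (a nonnegative square matrix some power of which is entrywise positive). *)

(* Defs.v *)
From mathcomp Require Import all_boot all_order all_algebra.
From mathcomp Require Import reals exp.

Set Implicit Arguments.
Unset Strict Implicit.
Unset Printing Implicit Defensive.

Import Order.TTheory GRing.Theory Num.Theory.
Local Open Scope ring_scope.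

(* The entry T_{i_1 i_2 ... i_m} is T (i_1, [tuple i_2; ...; i_m]): every
   notion below distinguishes the first index from the m - 1 others.
   Meaningful for 0 < m only. *)
Notation tensor R m n := {ffun 'I_n * m.-1.-tuple 'I_n -> R} (only parsing).

Definition nonneg_tensor (R : realType) (m n : nat) (T : tensor R m n) : Prop :=
  forall (i : 'I_n) (s : m.-1.-tuple 'I_n), 0 <= T (i, s).

Definition identity_tensor (R : realType) (m n : nat) : tensor R m n :=
  [ffun p : 'I_n * m.-1.-tuple 'I_n => (all (pred1 p.1) p.2)%:R].

Definition nonneg_vec (R : realType) (n : nat) (x : 'cV[R]_n) : Prop :=
  forall i, 0 <= x i 0.

Definition pos_vec (R : realType) (n : nat) (x : 'cV[R]_n) : Prop :=
  forall i, 0 < x i 0.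

(* T x^{m-1} *)
Definition tensor_apply (R : realType) (m n : nat) (T : tensor R m n)
    (x : 'cV[R]_n) : 'cV[R]_n :=
  \col_i \sum_(s : m.-1.-tuple 'I_n) T (i, s) * \prod_(j <- s) x j 0.

(* F_T, as a total map; only its values on nonnegative vectors, for T
   nonnegative and 2 <= m, are relevant (there 0 `^ (m - 1)^-1 = 0). *)
Definition tensor_map (R : realType) (m n : nat) (T : tensor R m n)
    (x : 'cV[R]_n) : 'cV[R]_n :=
  \col_i (tensor_apply T x i 0) `^ (m.-1)%:R^-1.

Definition reducible_tensor (R : realType) (m n : nat)
    (T : tensor R m n) : Prop :=
  exists I : {set 'I_n},
    [/\ I != set0, I != [set: 'I_n] &
        forall (i : 'I_n) (s : m.-1.-tuple 'I_n),
          i \in I -> (forall j, j \in s -> j \notin I) -> T (i, s) = 0].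

Definition irreducible_tensor (R : realType) (m n : nat)
    (T : tensor R m n) : Prop :=
  ~ reducible_tensor T.

Definition essentially_positive (R : realType) (m n : nat)
    (T : tensor R m n) : Prop :=
  forall x : 'cV[R]_n, nonneg_vec x -> x <> 0 -> pos_vec (tensor_apply T x).

Definition primitive_tensor (R : realType) (m n : nat)
    (T : tensor R m n) : Prop :=
  exists k : nat, (0 < k)%N /\
    forall x : 'cV[R]_n,
      nonneg_vec x -> x <> 0 -> pos_vec (iter k (tensor_map T) x).

Definition weakly_positive (R : realType) (m n : nat)
    (T : tensor R m n) : Prop :=
  forall i j : 'I_n, i <> j -> 0 < T (i, nseq_tuple m.-1 j).

(* G(T) *)
Definition representation (R : realType) (m n : nat) (T : tensor R m n) :
    'M[R]_n :=
  \matrix_(i, j) \sum_(s : m.-1.-tuple 'I_n | j \in s) T (i, s).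

Definition reducible_mx (R : realType) (n : nat) (A : 'M[R]_n) : Prop :=
  exists I : {set 'I_n},
    [/\ I != set0, I != [set: 'I_n] &
        forall i j : 'I_n, i \in I -> j \notin I -> A i j = 0].

Definition irreducible_mx (R : realType) (n : nat) (A : 'M[R]_n) : Prop :=
  ~ reducible_mx A.

Definition primitive_mx (R : realType) (n : nat) (A : 'M[R]_n) : Prop :=
  (forall i j : 'I_n, 0 <= A i j) /\
  exists k : nat, (0 < k)%N /\ forall i j : 'I_n, 0 < (A ^+ k) i j.

Definition weakly_irreducible (R : realType) (m n : nat)
    (T : tensor R m n) : Prop :=
  irreducible_mx (representation T).

Definition weakly_primitive (R : realType) (m n : nat)
    (T : tensor R m n) : Prop :=
  primitive_mx (representation T).

Definition positive_diagonal (R : realType) (m n : nat)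
    (T : tensor R m n) : Prop :=
  forall i : 'I_n, 0 < T (i, nseq_tuple m.-1 i).

(* Main.v *)
Require Import Defs.
From mathcomp Require Import all_boot all_order all_algebra.
From mathcomp Require Import reals exp.
From mathcomp Require Import zify.

(** Everything here only depends on which coordinates of a nonnegative vector
    are nonzero. If [T] is nonnegative, the support of [F_T x] is a function
    [tensor_reach T] of the support of [x], and likewise for [x |-> M x] with a
    nonnegative matrix [M] ([support_tensor_map], [support_mulmx]).

    (1) and (2). Adding the identity makes this map [f] on sets inflationary,
    i.e. [S \subset f S]. A nonempty proper [S] with [f S = S] traps all the
    iterates of a vector of support [S], which contradicts primitivity. If there
    is no such [S], each application of [f] adds an index until all of them are
    reached, so after [n] steps every nonzero nonnegative vector is positive
    ([eventually_positiveP]). Moreover [f S = S] says exactly that the complement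
    of [S] witnesses reducibility of the tensor or of the matrix before the
    identity was added: the identity contributes nothing outside [S]. For (1)
    one also needs that the representation of [T + E] is that of [T] plus the
    identity matrix ([representationD1]).

    (3) and (4). Testing on the unit vectors shows that [T] is essentially
    positive if and only if all the entries [T_{ij...j}] are positive, [i = j]
    included ([essentially_positiveP]). The two claims are then read off, since
    [E] adds [1] to the diagonal entries and nothing to the entries [T_{ij...j}]
    with [i <> j]. *)

Set Implicit Arguments.
Unset Strict Implicit.
Unset Printing Implicit Defensive.

Import Order.TTheory GRing.Theory Num.Theory.
Local Open Scope ring_scope.

(** * Inflationary set maps *)

Definition no_proper_fixpoint (I : finType) (f : {set I} -> {set I}) : Prop :=
  forall S : {set I}, f S = S -> S = set0 \/ S = setT.

(** Without a nonempty proper fixed point, the cardinality strictly increases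
    at every step until the whole type is reached. *)
Lemma iter_inflationary_full (I : finType) (f : {set I} -> {set I})
    (S : {set I}) (k : nat) :
  (forall A : {set I}, A \subset f A) -> no_proper_fixpoint f ->
  S != set0 -> (#|I| <= k)%N -> iter k f S = setT.
Proof.
move=> infl nofix S0 leIk.
suff grow j : (minn j.+1 #|I| <= #|iter j f S|)%N.
  apply/eqP; rewrite eqEcard subsetT cardsT (leq_trans _ (grow k)) //.
  by rewrite leq_min leqnn andbT ltnW.
elim: j => [|j IHj]; first by rewrite geq_min card_gt0 S0.
rewrite iterS; set A := iter j f S in IHj *.
have [fixA|neqA] := eqVneq (f A) A.
  case: (nofix A fixA) => AE; last by rewrite fixA AE cardsT geq_minr.
  by move: IHj; rewrite AE cards0 geq_min /= leqn0 => /eqP ->; rewrite minn0.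
have ltA : (#|A| < #|f A|)%N.
  by apply: proper_card; rewrite properEneq infl eq_sym neqA.
apply: leq_trans ltA.
by move: IHj; lia.
Qed.

(** * Supports of nonnegative vectors *)

Definition support (R : realType) (n : nat) (x : 'cV[R]_n) : {set 'I_n} :=
  [set i | 0 < x i 0].

Definition indicator (R : realType) (n : nat) (S : {set 'I_n}) : 'cV[R]_n :=
  \col_i (i \in S)%:R.

Lemma nonneg_indicator (R : realType) (n : nat) (S : {set 'I_n}) :
  nonneg_vec (indicator R S).
Proof. by move=> i; rewrite mxE ler0n. Qed.

Lemma support_indicator (R : realType) (n : nat) (S : {set 'I_n}) :
  support (indicator R S) = S.
Proof. by apply/setP=> i; rewrite inE mxE ltr0n lt0b. Qed.

Lemma pos_vecP (R : realType) (n : nat) (x : 'cV[R]_n) :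
  pos_vec x <-> support x = setT.
Proof.
split=> [x_gt0|xT i]; first by apply/setP=> i; rewrite !inE x_gt0.
by move/setP/(_ i): xT; rewrite !inE.
Qed.

Lemma support_neq0 (R : realType) (n : nat) (x : 'cV[R]_n) :
  nonneg_vec x -> x <> 0 <-> support x != set0.
Proof.
move=> x_ge0; split=> [xN0|/set0Pn[i]]; last first.
  by rewrite inE => xi_gt0 x0; rewrite x0 mxE ltxx in xi_gt0.
apply/negP=> /eqP supp0; apply: xN0; apply/colP=> i; rewrite mxE.
apply/eqP; move/setP/(_ i): supp0; rewrite !inE lt_neqAle x_ge0 andbT.
by move/negbFE; rewrite eq_sym.
Qed.

Lemma indicator_set1_neq0 (R : realType) (n : nat) (j : 'I_n) :
  indicator R [set j] <> 0.
Proof.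
apply/(support_neq0 (nonneg_indicator R [set j])); rewrite support_indicator.
by apply/set0Pn; exists j; rewrite set11.
Qed.

(** The map [f] on sets is well defined by [F] alone, as every set is the
    support of its indicator vector. *)
Definition support_map (R : realType) (n : nat) (F : 'cV[R]_n -> 'cV[R]_n)
    (f : {set 'I_n} -> {set 'I_n}) : Prop :=
  forall x, nonneg_vec x -> nonneg_vec (F x) /\ support (F x) = f (support x).

Lemma support_iter (R : realType) (n : nat) (F : 'cV[R]_n -> 'cV[R]_n)
    (f : {set 'I_n} -> {set 'I_n}) (k : nat) :
  support_map F f -> support_map (iter k F) (iter k f).
Proof.
move=> Ff x x_ge0; elim: k => [|k [IHge0 IHsupp]] //=.
by have [? ->] := Ff _ IHge0; rewrite IHsupp.
Qed.

Definition eventually_positive (R : realType) (n : nat)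
    (F : 'cV[R]_n -> 'cV[R]_n) : Prop :=
  exists k : nat, (0 < k)%N /\
    forall x, nonneg_vec x -> x <> 0 -> pos_vec (iter k F x).

(** Primitivity of a tensor and of a matrix are both instances of
    [eventually_positive], so this reduces them to fixed points on sets. *)
Lemma eventually_positiveP (R : realType) (n : nat) (F : 'cV[R]_n -> 'cV[R]_n)
    (f : {set 'I_n} -> {set 'I_n}) :
  support_map F f -> (forall S : {set 'I_n}, S \subset f S) ->
  no_proper_fixpoint f <-> eventually_positive F.
Proof.
move=> Ff infl; split=> [nofix|[k [_ Fk_pos]] S fixS].
  (* [n.+1] rather than [n] so that the exponent is positive for all [n]. *)
  exists n.+1; split=> // x x_ge0 /(support_neq0 x_ge0) suppx.
  apply/pos_vecP; have [_ ->] := support_iter n.+1 Ff x_ge0.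
  by apply: iter_inflationary_full; rewrite ?card_ord.
have [->|S0] := eqVneq S set0; [by left | right].
have ge0 := nonneg_indicator R S.
have : pos_vec (iter k F (indicator R S)).
  by apply: Fk_pos => //; apply/(support_neq0 ge0); rewrite support_indicator.
move/pos_vecP; have [_ ->] := support_iter k Ff ge0.
by rewrite support_indicator iter_fix.
Qed.

(** * Nonnegative matrices *)

Definition mx_reach (R : realType) (n : nat) (M : 'M[R]_n) (S : {set 'I_n}) :
    {set 'I_n} :=
  [set i | [exists j in S, 0 < M i j]].

Lemma support_mulmx (R : realType) (n : nat) (M : 'M[R]_n) :
  (forall i j, 0 <= M i j) -> support_map (mulmx M) (mx_reach M).
Proof.
move=> M_ge0 x x_ge0.
have term_ge0 i j : 0 <= M i j * x j 0 by rewrite mulr_ge0.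
have Mx_ge0 : nonneg_vec (M *m x) by move=> i; rewrite mxE sumr_ge0.
split=> //; apply/setP=> i; rewrite !inE mxE lt_neqAle sumr_ge0 // andbT.
rewrite eq_sym psumr_neq0 //; apply/hasP/existsP => [[j _]|[j]].
  rewrite /= lt_neqAle eq_sym mulf_eq0 negb_or -andbA => /and3P[Mij xj _].
  by exists j; rewrite inE !lt_neqAle !(eq_sym 0) Mij xj x_ge0 M_ge0.
rewrite inE => /andP[xj Mij]; exists j; first by rewrite mem_index_enum.
exact: mulr_gt0.
Qed.

Lemma gt0_mxP (R : realType) (n : nat) (M : 'M[R]_n) :
  (forall i j, 0 < M i j) <->
  (forall x, nonneg_vec x -> x <> 0 -> pos_vec (M *m x)).
Proof.
split=> [M_gt0 x x_ge0 /(support_neq0 x_ge0)/set0Pn[j xj] | M_pos i j].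
  apply/pos_vecP; have M_ge0 i k : 0 <= M i k by exact: ltW.
  have [_ ->] := support_mulmx M_ge0 x_ge0.
  by apply/setP=> i; rewrite !inE; apply/existsP; exists j; rewrite xj M_gt0.
have ge0 := nonneg_indicator R [set j].
have := M_pos _ ge0 (@indicator_set1_neq0 R n j) i; rewrite mxE (bigD1 j) //= mxE set11 mulr1.
by rewrite big1 ?addr0 // => k kj; rewrite mxE inE (negPf kj) mulr0.
Qed.

Lemma iter_mulmx (R : realType) (n : nat) (M : 'M[R]_n) (k : nat) (x : 'cV_n) :
  iter k (mulmx M) x = (M ^+ k) *m x.
Proof.
by elim: k => [|k IHk] /=; rewrite ?expr0 ?mul1mx // exprS -mulmxA IHk.
Qed.

Lemma primitive_mxP (R : realType) (n : nat) (M : 'M[R]_n) :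
  (forall i j, 0 <= M i j) ->
  primitive_mx M <-> eventually_positive (mulmx M).
Proof.
move=> M_ge0; split=> [[_ [k [k_gt0 Mk]]]|[k [k_gt0 Mk]]]; last split => //.
  exists k; split=> // x; rewrite iter_mulmx; move: x.
  by apply/gt0_mxP.
exists k; split=> //; apply/gt0_mxP => x.
by rewrite -iter_mulmx; exact: Mk.
Qed.

(** A set [S] is fixed exactly when its complement witnesses reducibility: no
    positive entry of [A] may lead from a row outside [S] to a column in [S],
    and the identity, being diagonal, has no such entry. *)
Lemma irreducible_mxP (R : realType) (n : nat) (A : 'M[R]_n) :
  (forall i j, 0 <= A i j) ->
  irreducible_mx A <-> no_proper_fixpoint (mx_reach (A + 1%:M)).
Proof.
move=> A_ge0; split=> [irrA S fixS|nofix [I [I0 IT AI]]].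
  have [->|S0] := eqVneq S set0; [by left | right].
  apply/eqP/negPn/negP=> ST; apply: irrA; exists (~: S); split.
  - by apply: contra ST => /eqP SC; rewrite -(setCK S) SC setC0.
  - by apply: contra S0 => /eqP SC; rewrite -(setCK S) SC setCT.
  move=> i j; rewrite !inE negbK => iS jS; apply/eqP/negPn/negP=> Aij.
  move/setP/(_ i): fixS; rewrite (negPf iS) inE => /negbT/negP; apply.
  apply/existsP; exists j; rewrite jS !mxE ltr_wpDr ?ler0n //.
  by rewrite lt_neqAle eq_sym Aij A_ge0.
case: (nofix (~: I)) => [|IC|IC]; last 2 first.
- by move: IT; rewrite -(setCK I) IC setC0 eqxx.
- by move: I0; rewrite -(setCK I) IC setCT eqxx.
apply/setP=> i; rewrite [LHS]inE; apply/existsP/idP => [[j]|iI]; last first.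
  by exists i; rewrite iI !mxE eqxx ltr_wpDl ?ltr01.
rewrite !inE !mxE => /andP[jI]; apply: contraTN => iI.
by rewrite AI // add0r ltr0n lt0b; apply: contraNneq jI => <-.
Qed.

(** * Nonnegative tensors *)

Definition tensor_reach (R : realType) (m n : nat) (T : tensor R m n)
    (S : {set 'I_n}) : {set 'I_n} :=
  [set i | [exists s : m.-1.-tuple 'I_n,
              (0 < T (i, s)) && all [in S] s]].

Lemma support_tensor_apply (R : realType) (m n : nat) (T : tensor R m n) :
  nonneg_tensor T -> support_map (tensor_apply T) (tensor_reach T).
Proof.
move=> T_ge0 x x_ge0.
have term_ge0 i (s : m.-1.-tuple 'I_n) : 0 <= T (i, s) * \prod_(j <- s) x j 0.
  by rewrite mulr_ge0 ?T_ge0 // prodr_ge0.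
have Tx_ge0 : nonneg_vec (tensor_apply T x).
  by move=> i; rewrite mxE sumr_ge0.
split=> //; apply/setP=> i; rewrite !inE mxE lt_neqAle sumr_ge0 // andbT.
rewrite eq_sym psumr_neq0 //; apply/hasP/existsP => [[s _]|[s]].
  rewrite /= lt_neqAle eq_sym mulf_eq0 negb_or -andbA => /and3P[Tis xs _].
  exists s; rewrite lt_neqAle eq_sym Tis T_ge0 /=.
  move: xs; rewrite prodf_seq_neq0; apply: sub_all => j /=.
  by rewrite inE lt_neqAle eq_sym => ->; rewrite x_ge0.
case/andP=> Tis /allP sS; exists s; first by rewrite mem_index_enum.
rewrite /= mulr_gt0 // big_seq prodr_gt0 // => j /sS.
by rewrite inE.
Qed.

(** Taking the root of order [m - 1 > 0] does not change the support. *)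
Lemma support_tensor_map (R : realType) (m n : nat) (T : tensor R m n) :
  (2 <= m)%N -> nonneg_tensor T ->
  support_map (tensor_map T) (tensor_reach T).
Proof.
move=> m_ge2 T_ge0 x x_ge0.
have [Tx_ge0 <-] := support_tensor_apply T_ge0 x_ge0.
split=> [i|]; first by rewrite mxE powR_ge0.
apply/setP=> i; rewrite !inE [in LHS]mxE; apply/idP/idP; last exact: powR_gt0.
apply: contraTT; rewrite -leNgt => Txi_le0.
have -> : tensor_apply T x i 0 = 0 by apply/le_anti; rewrite Txi_le0 Tx_ge0.
rewrite powR0 ?ltxx // invr_eq0 pnatr_eq0.
by rewrite -lt0n; case: m m_ge2 {T T_ge0 Tx_ge0 Txi_le0} => [|[]].
Qed.

Lemma identity_tensor_ge0 (R : realType) (m n : nat) :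
  nonneg_tensor (identity_tensor R m n).
Proof. by move=> i s; rewrite ffunE ler0n. Qed.

Lemma nonneg_tensorD1 (R : realType) (m n : nat) (T : tensor R m n) :
  nonneg_tensor T -> nonneg_tensor (T + identity_tensor R m n).
Proof. by move=> T_ge0 i s; rewrite ffunE addr_ge0 ?identity_tensor_ge0. Qed.

Lemma identity_tensor_nseq (R : realType) (m n : nat) (i j : 'I_n) :
  (2 <= m)%N ->
  identity_tensor R m n (i, nseq_tuple m.-1 j) = (i == j)%:R.
Proof.
case: m => [|[|m]] // _.
rewrite ffunE /= all_nseq /= eq_sym; congr (_%:R).
by case: (i == j); rewrite ?orbT ?andbF.
Qed.

Lemma tensor_reachD1_infl (R : realType) (m n : nat) (T : tensor R m n)
    (S : {set 'I_n}) :
  (2 <= m)%N -> nonneg_tensor T ->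
  S \subset tensor_reach (T + identity_tensor R m n) S.
Proof.
move=> m_ge2 T_ge0; apply/subsetP=> i iS; rewrite inE; apply/existsP.
exists (nseq_tuple m.-1 i).
rewrite ffunE identity_tensor_nseq // eqxx ltr_wpDl ?ltr01 //=.
by rewrite all_nseq /= iS orbT.
Qed.

(** A set [S] is fixed exactly when its complement witnesses reducibility;
    an identity entry [(i, s)] with all of [s] in [S] has [i] in [S], because
    [s] is not empty. *)
Lemma irreducible_tensorP (R : realType) (m n : nat) (T : tensor R m n) :
  (2 <= m)%N -> nonneg_tensor T ->
  irreducible_tensor T <->
  no_proper_fixpoint (tensor_reach (T + identity_tensor R m n)).
Proof.
move=> m_ge2 T_ge0; split=> [irrT S fixS|nofix [I [I0 IT TI]]].
  have [->|S0] := eqVneq S set0; [by left | right].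
  apply/eqP/negPn/negP=> ST; apply: irrT; exists (~: S); split.
  - by apply: contra ST => /eqP SC; rewrite -(setCK S) SC setC0.
  - by apply: contra S0 => /eqP SC; rewrite -(setCK S) SC setCT.
  move=> i s; rewrite !inE => iS sS; apply/eqP/negPn/negP=> Tis.
  move/setP/(_ i): fixS; rewrite (negPf iS) inE => /negbT/negP; apply.
  apply/existsP; exists s; apply/andP; split.
    by rewrite ffunE ltr_wpDr ?identity_tensor_ge0 // lt_neqAle eq_sym Tis T_ge0.
  by apply/allP=> j /sS; rewrite inE negbK.
case: (nofix (~: I)) => [|IC|IC]; last 2 first.
- by move: IT; rewrite -(setCK I) IC setC0 eqxx.
- by move: I0; rewrite -(setCK I) IC setCT eqxx.
apply/eqP; rewrite eqEsubset tensor_reachD1_infl // andbT.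
apply/subsetP=> i; rewrite inE => /existsP[s /andP[Tis /allP sI]].
rewrite inE; apply: contraTN Tis => iI.
rewrite ffunE TI // ?add0r => [|j /sI]; last by rewrite inE.
rewrite ffunE ltr0n lt0b /=; apply/allPn.
have s0 : (0 < size s)%N by rewrite size_tuple; lia.
exists (nth i s 0); first exact: mem_nth.
apply: contraTneq iI => {1}<-.
by have := sI _ (mem_nth i s0); rewrite inE.
Qed.

Lemma primitive_tensorD1P (R : realType) (m n : nat) (T : tensor R m n) :
  (2 <= m)%N -> nonneg_tensor T ->
  irreducible_tensor T <-> primitive_tensor (T + identity_tensor R m n).
Proof.
move=> m_ge2 T_ge0; apply: iff_trans (irreducible_tensorP m_ge2 T_ge0) _.
apply: eventually_positiveP => [|S]; last exact: tensor_reachD1_infl.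
exact: support_tensor_map m_ge2 (nonneg_tensorD1 T_ge0).
Qed.

(** * The representation matrix *)

Lemma representation_ge0 (R : realType) (m n : nat) (T : tensor R m n) i j :
  nonneg_tensor T -> 0 <= representation T i j.
Proof. by move=> T_ge0; rewrite mxE sumr_ge0. Qed.

(** Among the tuples containing [j], the only one on which the identity tensor
    can be nonzero is the constant one. *)
Lemma representationD1 (R : realType) (m n : nat) (T : tensor R m n) :
  (2 <= m)%N ->
  representation (T + identity_tensor R m n) = representation T + 1%:M.
Proof.
move=> m_ge2; apply/matrixP=> i j; rewrite !mxE.
under eq_bigr do rewrite ffunE.
rewrite big_split /=; congr (_ + _).
rewrite (bigD1 (nseq_tuple m.-1 j)) /=; last first.
  by rewrite mem_nseq eqxx andbT; lia.
rewrite identity_tensor_nseq // big1 ?addr0 // => s /andP[js sj].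
rewrite ffunE /=; case: allP => // sE; case/eqP: sj; apply: val_inj => /=.
have ij := eqP (sE j js).
rewrite -[in RHS](size_tuple s) ij.
by apply/all_pred1P/allP.
Qed.

Lemma weakly_primitiveD1P (R : realType) (m n : nat) (T : tensor R m n) :
  (2 <= m)%N -> nonneg_tensor T ->
  weakly_irreducible T <-> weakly_primitive (T + identity_tensor R m n).
Proof.
move=> m_ge2 T_ge0.
have G_ge0 i j := representation_ge0 i j T_ge0.
have GD1_ge0 i j : 0 <= (representation T + 1%:M) i j.
  by rewrite mxE [X in _ + X]mxE addr_ge0 ?ler0n.
rewrite /weakly_primitive representationD1 //.
apply: iff_trans (irreducible_mxP G_ge0) _.
apply: iff_trans (iff_sym (primitive_mxP GD1_ge0)).
apply: eventually_positiveP => [|S]; first exact: support_mulmx.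
apply/subsetP=> i iS; rewrite inE; apply/existsP; exists i.
by rewrite iS mxE [X in _ + X]mxE eqxx ltr_wpDl ?ltr01.
Qed.

(** * Essential positivity *)

(** For a vector with positive coordinate [j] the term of the constant tuple
    [j] is enough; for the unit vector of index [j] it is the only one. *)
Lemma essentially_positiveP (R : realType) (m n : nat) (T : tensor R m n) :
  nonneg_tensor T ->
  essentially_positive T <-> forall i j, 0 < T (i, nseq_tuple m.-1 j).
Proof.
move=> T_ge0; split=> [Tpos i j|T_gt0 x x_ge0 /(support_neq0 x_ge0)/set0Pn[j xj]].
  have ge0 := nonneg_indicator R [set j].
  have := Tpos _ ge0 (@indicator_set1_neq0 R n j); move/pos_vecP.
  have [_ ->] := support_tensor_apply T_ge0 ge0.
  rewrite support_indicator => /setP/(_ i); rewrite !inE.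
  case/existsP=> s /andP[Tis sj].
  suff -> : nseq_tuple m.-1 j = s by [].
  apply: val_inj; apply/esym; rewrite /= -[in RHS](size_tuple s).
  apply/all_pred1P; apply: sub_all sj => k.
  by rewrite /= inE.
apply/pos_vecP; have [_ ->] := support_tensor_apply T_ge0 x_ge0.
apply/setP=> i; rewrite !inE; apply/existsP; exists (nseq_tuple m.-1 j).
by rewrite T_gt0 all_nseq /= xj orbT.
Qed.

Theorem theorem3p1 (R : realType) (m n : nat) (hm : (2 <= m)%N) (hn : (2 <= n)%N)
    (T : tensor R m n) (hT : nonneg_tensor T) :
  (weakly_irreducible T <-> weakly_primitive (T + identity_tensor R m n)) /\
  (irreducible_tensor T <-> primitive_tensor (T + identity_tensor R m n)) /\
  (weakly_positive T <-> essentially_positive (T + identity_tensor R m n)) /\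
  (essentially_positive T <-> weakly_positive T /\ positive_diagonal T).
Proof.
split; first exact: weakly_primitiveD1P.
split; first exact: primitive_tensorD1P.
split.
  apply: iff_trans (iff_sym (essentially_positiveP (nonneg_tensorD1 hT))).
  split=> [wposT i j|TD1_gt0 i j /eqP ij].
    rewrite ffunE identity_tensor_nseq //; have [<-|/eqP ij] := eqVneq i j.
      by rewrite ltr_wpDl ?ltr01.
    by rewrite addr0 wposT.
  have := TD1_gt0 i j.
  by rewrite ffunE identity_tensor_nseq // (negPf ij) addr0.
apply: iff_trans (essentially_positiveP hT) _.
split=> [T_gt0|[wposT diagT] i j]; first by split=> [i j _|i].
by have [<-|/eqP ij] := eqVneq i j; [exact: diagT | exact: wposT].
Qed.
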